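(* The set of all complex structures on $\mathfrak{su}(2)\oplus\mathfrak{su}(2)$ consists exactly of the matrices $$\begin{pmatrix} \lambda_1^2\xi & -\lambda_1\mu_1\xi+\nu_1 & \lambda_1\nu_1\xi+\mu_1 & \eta\lambda_1\lambda_2 & -\eta\lambda_1\mu_2 & \eta\lambda_1\nu_2\\ -\lambda_1\mu_1\xi-\nu_1 & \mu_1^2\xi & \lambda_1-\mu_1\nu_1\xi & -\eta\mu_1\lambda_2 & \eta\mu_1\mu_2 & -\eta\mu_1\nu_2\\ \lambda_1\nu_1\xi-\mu_1 & -\lambda_1-\mu_1\nu_1\xi & \nu_1^2\xi & \eta\nu_1\lambda_2 & -\eta\nu_1\mu_2 & \eta\nu_1\nu_2\\ -\frac{\xi^2+1}{\eta}\lambda_1\lambda_2 & \frac{\xi^2+1}{\eta}\mu_1\lambda_2 & -\frac{\xi^2+1}{\eta}\nu_1\lambda_2 & -\lambda_2^2\xi & \lambda_2\mu_2\xi+\nu_2 & -\lambda_2\nu_2\xi+\mu_2\\ \frac{\xi^2+1}{\eta}\lambda_1\mu_2 & -\frac{\xi^2+1}{\eta}\mu_1\mu_2 & \frac{\xi^2+1}{\eta}\nu_1\mu_2 & \lambda_2\mu_2\xi-\nu_2 & -\mu_2^2\xi & \lambda_2+\mu_2\nu_2\xi\\ -\frac{\xi^2+1}{\eta}\lambda_1\nu_2 & \frac{\xi^2+1}{\eta}\mu_1\nu_2 & -\frac{\xi^2+1}{\eta}\nu_1\nu_2 & -\lambda_2\nu_2\xi-\mu_2 & -\lambda_2+\mu_2\nu_2\xi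 & -\nu_2^2\xi \end{pmatrix}$$ with $(\xi,\eta)\in\mathbb{R}\times\mathbb{R}^*$ and $(\lambda_i,\mu_i,\nu_i)\in\mathbb{S}^2$ for $i=1,2$.
   Context: $\mathfrak{su}(2)\oplus\mathfrak{su}(2)$ has basis $(J^{(1)}_1,J^{(1)}_2,J^{(1)}_3,J^{(2)}_1,J^{(2)}_2,J^{(2)}_3)$, where for each $k=1,2$: $[J^{(k)}_1,J^{(k)}_2]=J^{(k)}_3$, $[J^{(k)}_2,J^{(k)}_3]=J^{(k)}_1$, $[J^{(k)}_3,J^{(k)}_1]=J^{(k)}_2$, and brackets between different factors vanish. Linear maps are identified with their matrices in this basis (columns are images of basis vectors). A complex structure on a real Lie algebra $\mathfrak{g}$ is a linear map $J:\mathfrak{g}\to\mathfrak{g}$ with $J^2=-1$ and $[JX,JY]-[X,Y]-J[JX,Y]-J[X,JY]=0$ for all $X,Y\in\mathfrak{g}$. $\mathbb{R}^*=\mathbb{R}\setminus\{0\}$ and $\mathbb{S}^2$ is the unit sphere in $\mathbb{R}^3$. *)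

(* Defs.v *)
From HB Require Import structures.
From mathcomp Require Import all_boot all_order all_algebra.
From mathcomp Require Import reals.
From mathcomp Require Import ring.

Set Implicit Arguments.
Unset Strict Implicit.
Unset Printing Implicit Defensive.

Import GRing.Theory.
Local Open Scope ring_scope.

Record lieAlgebra (R : realType) := LieAlgebra {
  lie_carrier :> lmodType R;
  lie_bracket : lie_carrier -> lie_carrier -> lie_carrier;
  lie_linearl : forall Y, linear (fun X => lie_bracket X Y);
  lie_linearr : forall X, linear (lie_bracket X);
  lie_alternating : forall X, lie_bracket X X = 0;
  lie_jacobi : forall X Y Z,
    lie_bracket X (lie_bracket Y Z) + lie_bracket Y (lie_bracket Z X)
      + lie_bracket Z (lie_bracket X Y) = 0
}.

Definition complex_structure (R : realType) (g : lieAlgebra R)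
    (J : {linear g -> g}) : Prop :=
  (forall X, J (J X) = - X) /\
  (forall X Y, lie_bracket (J X) (J Y) - lie_bracket X Y
     - J (lie_bracket (J X) Y) - J (lie_bracket X (J Y)) = 0).

(* su(2) in coordinates: the bracket with [e_1,e_2] = e_3, [e_2,e_3] = e_1,
   [e_3,e_1] = e_2 is the cross product of column vectors. *)
Definition su2_bracket (R : realType) (u v : 'cV[R]_3) : 'cV[R]_3 :=
  let x (i : nat) := u (inord i) 0 in
  let y (i : nat) := v (inord i) 0 in
  \col_(i < 3) [:: x 1%N * y 2%N - x 2%N * y 1%N;
                   x 2%N * y 0%N - x 0%N * y 2%N;
                   x 0%N * y 1%N - x 1%N * y 0%N]`_i.

Definition su2su2_bracket (R : realType) (X Y : 'cV[R]_(3 + 3)) :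
    'cV[R]_(3 + 3) :=
  col_mx (su2_bracket (usubmx X) (usubmx Y))
         (su2_bracket (dsubmx X) (dsubmx Y)).

Section LieAxioms.
Variable R : realType.

Lemma col3P (u v : 'cV[R]_3) :
  u (inord 0) 0 = v (inord 0) 0 -> u (inord 1) 0 = v (inord 1) 0 ->
  u (inord 2) 0 = v (inord 2) 0 -> u = v.
Proof.
move=> h0 h1 h2; apply/matrixP => i j; rewrite ord1.
rewrite -(inord_val i); case: i => -[|[|[|//]]] lti //.
Qed.

Lemma su2_linearl (v : 'cV[R]_3) : linear (fun u => su2_bracket u v).
Proof.
by move=> a u w; apply: col3P; rewrite /su2_bracket !mxE !inordK //= ?mxE; ring.
Qed.

Lemma su2_linearr (u : 'cV[R]_3) : linear (su2_bracket u).
Proof.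
by move=> a v w; apply: col3P; rewrite /su2_bracket !mxE !inordK //= ?mxE; ring.
Qed.

Lemma su2_alternating (u : 'cV[R]_3) : su2_bracket u u = 0.
Proof. by apply: col3P; rewrite /su2_bracket !mxE !inordK //=; ring. Qed.

Lemma su2_jacobi (u v w : 'cV[R]_3) :
  su2_bracket u (su2_bracket v w) + su2_bracket v (su2_bracket w u)
    + su2_bracket w (su2_bracket u v) = 0.
Proof. by apply: col3P; rewrite /su2_bracket !mxE !inordK //=; ring. Qed.

Lemma su2su2_linearl (Y : 'cV[R]_(3 + 3)) :
  linear (fun X => su2su2_bracket X Y).
Proof.
by move=> a X Z; rewrite /su2su2_bracket !linearP !su2_linearl scale_col_mx
  add_col_mx.
Qed.

Lemma su2su2_linearr (X : 'cV[R]_(3 + 3)) : linear (su2su2_bracket X).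
Proof.
by move=> a Y Z; rewrite /su2su2_bracket !linearP !su2_linearr scale_col_mx
  add_col_mx.
Qed.

Lemma su2su2_alternating (X : 'cV[R]_(3 + 3)) : su2su2_bracket X X = 0.
Proof. by rewrite /su2su2_bracket !su2_alternating col_mx0. Qed.

Lemma su2su2_jacobi (X Y Z : 'cV[R]_(3 + 3)) :
  su2su2_bracket X (su2su2_bracket Y Z) + su2su2_bracket Y (su2su2_bracket Z X)
    + su2su2_bracket Z (su2su2_bracket X Y) = 0.
Proof.
by rewrite /su2su2_bracket !col_mxKu !col_mxKd !add_col_mx !su2_jacobi col_mx0.
Qed.

End LieAxioms.

Definition su2su2 (R : realType) : lieAlgebra R :=
  LieAlgebra (@su2su2_linearl R) (@su2su2_linearr R) (@su2su2_alternating R)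
    (@su2su2_jacobi R).

(* The basis J^(1)_i, J^(2)_i, with i counted from 0. *)
Definition J1 (R : realType) (i : nat) : su2su2 R :=
  delta_mx (lshift 3 (inord i : 'I_3)) 0 : 'cV[R]_(3 + 3).

Definition J2 (R : realType) (i : nat) : su2su2 R :=
  delta_mx (rshift 3 (inord i : 'I_3)) 0 : 'cV[R]_(3 + 3).

Section Relations.
Variable R : realType.

Let e (i : nat) : 'cV[R]_3 := delta_mx (inord i) 0.

Let J1E i : J1 R i = col_mx (e i) 0.
Proof.
apply/colP => j; rewrite -(splitK j).
by case: (split j) => k; rewrite /= ?col_mxEu ?col_mxEd !mxE
  ?eq_lshift ?eq_rshift ?eq_lrshift ?eq_rlshift.
Qed.

Let J2E i : J2 R i = col_mx 0 (e i).
Proof.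
apply/colP => j; rewrite -(splitK j).
by case: (split j) => k; rewrite /= ?col_mxEu ?col_mxEd !mxE
  ?eq_lshift ?eq_rshift ?eq_lrshift ?eq_rlshift.
Qed.

Let e_rel : [/\ su2_bracket (e 0) (e 1) = e 2, su2_bracket (e 1) (e 2) = e 0
  & su2_bracket (e 2) (e 0) = e 1].
Proof.
split; apply: col3P; rewrite /su2_bracket /e !mxE -!val_eqE /= !inordK //=;
  ring.
Qed.

Let b0l (u : 'cV[R]_3) : su2_bracket 0 u = 0.
Proof. by apply: col3P; rewrite /su2_bracket !mxE !inordK //=; ring. Qed.

Let b0r (u : 'cV[R]_3) : su2_bracket u 0 = 0.
Proof. by apply: col3P; rewrite /su2_bracket !mxE !inordK //=; ring. Qed.

Lemma su2su2_rel1 : [/\ lie_bracket (J1 R 0) (J1 R 1) = J1 R 2,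
  lie_bracket (J1 R 1) (J1 R 2) = J1 R 0
  & lie_bracket (J1 R 2) (J1 R 0) = J1 R 1].
Proof.
case: e_rel => h0 h1 h2; rewrite !J1E /= /su2su2_bracket.
by rewrite !col_mxKu !col_mxKd h0 h1 h2 !b0l.
Qed.

Lemma su2su2_rel2 : [/\ lie_bracket (J2 R 0) (J2 R 1) = J2 R 2,
  lie_bracket (J2 R 1) (J2 R 2) = J2 R 0
  & lie_bracket (J2 R 2) (J2 R 0) = J2 R 1].
Proof.
case: e_rel => h0 h1 h2; rewrite !J2E /= /su2su2_bracket.
by rewrite !col_mxKu !col_mxKd h0 h1 h2 !b0l.
Qed.

Lemma su2su2_rel12 i j : lie_bracket (J1 R i) (J2 R j) = 0.
Proof.
by rewrite J1E J2E /= /su2su2_bracket !col_mxKu !col_mxKd b0l b0r col_mx0.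
Qed.

End Relations.

(* Left multiplication on columns: column j of A is the image of the j-th basis
   vector. *)
Definition endo_of_mx (R : realType) (A : 'M[R]_(3 + 3)) :
    {linear su2su2 R -> su2su2 R} :=
  mulmx A : {linear 'cV[R]_(3 + 3) -> 'cV[R]_(3 + 3)}.

Definition in_sphere2 (R : realType) (l m n : R) : Prop :=
  l ^+ 2 + m ^+ 2 + n ^+ 2 = 1.

Definition cs_matrix (R : realType) (xi eta l1 m1 n1 l2 m2 n2 : R) :
    'M[R]_(3 + 3) :=
  let k := (xi ^+ 2 + 1) / eta in
  let rows :=
  [:: [:: l1 ^+ 2 * xi; - (l1 * m1 * xi) + n1; l1 * n1 * xi + m1;
          eta * l1 * l2; - (eta * l1 * m2); eta * l1 * n2];
      [:: - (l1 * m1 * xi) - n1; m1 ^+ 2 * xi; l1 - m1 * n1 * xi;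
          - (eta * m1 * l2); eta * m1 * m2; - (eta * m1 * n2)];
      [:: l1 * n1 * xi - m1; - l1 - m1 * n1 * xi; n1 ^+ 2 * xi;
          eta * n1 * l2; - (eta * n1 * m2); eta * n1 * n2];
      [:: - (k * l1 * l2); k * m1 * l2; - (k * n1 * l2);
          - (l2 ^+ 2 * xi); l2 * m2 * xi + n2; - (l2 * n2 * xi) + m2];
      [:: k * l1 * m2; - (k * m1 * m2); k * n1 * m2;
          l2 * m2 * xi - n2; - (m2 ^+ 2 * xi); l2 + m2 * n2 * xi];
      [:: - (k * l1 * n2); k * m1 * n2; - (k * n1 * n2);
          - (l2 * n2 * xi) - m2; - l2 + m2 * n2 * xi; - (n2 ^+ 2 * xi)]] in
  \matrix_(i < 3 + 3, j < 3 + 3) (nth [::] rows i)`_j.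

(* Main.v *)
(* Identify su(2) with R^3 and the cross product and write the endomorphism in
   blocks [P Q; S T]. With [P = M + hat w], [M] symmetric and [t = tr P], the
   integrability condition on the first factor alone reads
   [P (t - P^T) = cof P - 1]. Its skew part is [M w = t w]; its trace, and its
   value on [w], force [|w| = 1] and [M = t w w^T], whereas [w = 0] would make
   [M] scalar with negative second elementary symmetric function. So
   [P = t a a^T + hat a] and likewise [T = s b b^T + hat b] with [a], [b] unit
   vectors. From [J^2 = -1], [Q b] is a multiple of [a] and [Q] intertwines
   [- hat a] and [hat b]; integrability on the second factor then kills [Q] on
   the orthogonal of [b], so [Q = eta a b^T]. Likewise for [S], and [J^2 = -1]
   determines the remaining coefficients. *)

Require Import Defs.
From mathcomp Require Import all_boot all_order all_algebra.
From mathcomp Require Import reals.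
From mathcomp Require Import ring lra.

Import GRing.Theory Num.Theory.
Local Open Scope ring_scope.

(** * The polynomial system for one factor *)

(* The unknown endomorphism of su(2) is [M + hat (u, v, w)] with [M] symmetric
   of rows [(p, x, y)], [(x, q, z)], [(y, z, r)]; [t] is the trace of [M] and
   [c] its second elementary symmetric function. *)
Lemma skew_plus_symmetric (R : realFieldType) (p q r x y z u v w : R)
    (t := p + q + r)
    (c := p * q + p * r + q * r - x ^+ 2 - y ^+ 2 - z ^+ 2)
    (n := u ^+ 2 + v ^+ 2 + w ^+ 2) :
  p * u + x * v + y * w = t * u ->
  x * u + q * v + z * w = t * v ->
  y * u + z * v + r * w = t * w ->
  2 * (t * p - (p ^+ 2 + x ^+ 2 + y ^+ 2)) + 2 * (x * w - y * v)
    = c + n - 1 ->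
  2 * (t * q - (x ^+ 2 + q ^+ 2 + z ^+ 2)) + 2 * (z * u - x * w)
    = c + n - 1 ->
  2 * (t * r - (y ^+ 2 + z ^+ 2 + r ^+ 2)) + 2 * (y * v - z * u)
    = c + n - 1 ->
  2 * (t * x - (p * x + x * q + y * z)) + (q * w - z * v + y * u - p * w) = 0 ->
  2 * (t * y - (p * y + x * z + y * r)) + (z * w - r * v + p * v - x * u) = 0 ->
  2 * (t * z - (x * y + q * z + z * r)) + (r * u - y * w + x * v - q * u) = 0 ->
  [/\ n = 1, [/\ p = t * u ^+ 2, q = t * v ^+ 2 & r = t * w ^+ 2]
    & [/\ x = t * (u * v), y = t * (u * w) & z = t * (v * w)]].
Proof.
move=> hu hv hw ep eq er ex ey ez.
(* Sum the three diagonal equations: the trace of [t M - M ^ 2] is [2 * c]. *)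
have cn : c = 3 * (n - 1).
  have: 4 * c = 3 * (c + n - 1).
    by move: ep eq er; rewrite /c /n /t => ep eq er; lra.
  lra.
(* Evaluate the symmetric equation as a quadratic form at [(u, v, w)]: since [M] multiplies this
   vector by [t], the left side vanishes. *)
have wEw : n * (c + n - 1) = 0.
  have h1 := congr1 ( *%R (u ^+ 2)) ep.
  have h2 := congr1 ( *%R (v ^+ 2)) eq.
  have h3 := congr1 ( *%R (w ^+ 2)) er.
  have h4 := congr1 ( *%R (2 * u * v)) ex.
  have h5 := congr1 ( *%R (2 * u * w)) ey.
  have h6 := congr1 ( *%R (2 * v * w)) ez.
  have h7 := congr1 ( *%R (p * u + x * v + y * w)) hu.
  have h8 := congr1 ( *%R (x * u + q * v + z * w)) hv.
  have h9 := congr1 ( *%R (y * u + z * v + r * w)) hw.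
  move: h1 h2 h3 h4 h5 h6 h7 h8 h9.
  set k := c + n - 1; move: (k) => {}k; rewrite /n /t; lra.
have [n0|n0] := eqVneq n 0.
  have [u0 v0 w0] : [/\ u = 0, v = 0 & w = 0].
    have hh := (sqr_ge0 u, sqr_ge0 v, sqr_ge0 w).
    by split; apply/eqP; rewrite -sqrf_eq0; apply/eqP; move: n0 hh;
      rewrite /n => ? [[? ?] ?]; lra.
  have c3 : c = - 3 by rewrite cn n0; ring.
  rewrite n0 c3 u0 v0 w0 in ep eq er ex ey ez.
  (* Cayley-Hamilton for [M], combined with [M ^ 2 = t M + 2] *)
  have cx : x = 0.
    have := (congr1 ( *%R p) ex, congr1 ( *%R x) eq, congr1 ( *%R y) ez,
      congr1 ( *%R x) c3).
    by rewrite /c /t => -[[[]]]; lra.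
  have cy : y = 0.
    have := (congr1 ( *%R p) ey, congr1 ( *%R x) ez, congr1 ( *%R y) er,
      congr1 ( *%R y) c3).
    by rewrite /c /t => -[[[]]]; lra.
  have cz : z = 0.
    have := (congr1 ( *%R x) ey, congr1 ( *%R q) ez, congr1 ( *%R z) er,
      congr1 ( *%R z) c3).
    by rewrite /c /t => -[[[]]]; lra.
  (* With [M] diagonal, each of [p], [q], [r] equals [- (p * q * r)]; then [c = 3 * p ^ 2]
     contradicts [c = - 3]. *)
  have [pq pr] : p = q /\ p = r.
    move: c3 ep eq er; rewrite /c /t cx cy cz => c3 ep eq er.
    have := (congr1 ( *%R p) ep, congr1 ( *%R q) eq, congr1 ( *%R r) er,
        congr1 ( *%R p) c3, congr1 ( *%R q) c3, congr1 ( *%R r) c3).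
    by move=> [[[[[? ?] ?] ?] ?] ?]; split; lra.
  have := sqr_ge0 p; move: c3; rewrite /c cx cy cz -pq -pr => ? ?; lra.
have {n0 wEw} c1n : c + n - 1 = 0.
  by move/eqP: wEw; rewrite mulf_eq0 (negPf n0) => /eqP.
have n1 : n = 1 by lra.
have {cn c1n} c0 : c = 0 by lra.
(* The squared Frobenius norm of [M - t w w^T], where [w] stands for the vector [(u, v, w)]; it
   expands to [t ^ 2 - 2 t ^ 2 + t ^ 2]. *)
suff sq : (p - t * u ^+ 2) ^+ 2 + (q - t * v ^+ 2) ^+ 2 + (r - t * w ^+ 2) ^+ 2
   + 2 * ((x - t * (u * v)) ^+ 2 + (y - t * (u * w)) ^+ 2
         + (z - t * (v * w)) ^+ 2) = 0.
  have hh := (sqr_ge0 (p - t * u ^+ 2), sqr_ge0 (q - t * v ^+ 2),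
    sqr_ge0 (r - t * w ^+ 2), sqr_ge0 (x - t * (u * v)),
    sqr_ge0 (y - t * (u * w)), sqr_ge0 (z - t * (v * w))).
  move: hh sq => [[[[[]]]]].
  set sp := (p - _) ^+ 2; set sq := (q - _) ^+ 2; set sr := (r - _) ^+ 2.
  set sx := (x - _) ^+ 2; set sy := (y - _) ^+ 2; set sz := (z - _) ^+ 2.
  move=> hp hq hr hx hy hz hs.
  split=> //; split; apply/eqP; rewrite -subr_eq0 -sqrf_eq0; apply/eqP.
  - by rewrite -/sp; lra.
  - by rewrite -/sq; lra.
  - by rewrite -/sr; lra.
  - by rewrite -/sx; lra.
  - by rewrite -/sy; lra.
  - by rewrite -/sz; lra.
have -> : (p - t * u ^+ 2) ^+ 2 + (q - t * v ^+ 2) ^+ 2 + (r - t * w ^+ 2) ^+ 2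
   + 2 * ((x - t * (u * v)) ^+ 2 + (y - t * (u * w)) ^+ 2
         + (z - t * (v * w)) ^+ 2)
   = t ^+ 2 - 2 * c - 2 * t * (u * (p * u + x * v + y * w)
      + v * (x * u + q * v + z * w) + w * (y * u + z * v + r * w))
     + t ^+ 2 * n ^+ 2 by rewrite /c /t /n; ring.
rewrite hu hv hw c0 n1.
have -> : u * (t * u) + v * (t * v) + w * (t * w) = t * n by rewrite /n; ring.
by rewrite n1; ring.
Qed.

(** * Cross product, hat map and inner product in dimension 3 *)

Section Su2.
Set Implicit Arguments.
Unset Strict Implicit.
Variable R : realType.
Implicit Types (a b u v x y : 'cV[R]_3) (P Q S T : 'M[R]_3).

Lemma su2_bracketE u v :
  (su2_bracket u v (inord 0) 0
     = u (inord 1) 0 * v (inord 2) 0 - u (inord 2) 0 * v (inord 1) 0)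
  * (su2_bracket u v (inord 1) 0
     = u (inord 2) 0 * v (inord 0) 0 - u (inord 0) 0 * v (inord 2) 0)
  * (su2_bracket u v (inord 2) 0
     = u (inord 0) 0 * v (inord 1) 0 - u (inord 1) 0 * v (inord 0) 0).
Proof. by rewrite /su2_bracket !mxE !inordK. Qed.

Lemma sum_ord3 (F : 'I_3 -> R) :
  \sum_i F i = F (inord 0) + F (inord 1) + F (inord 2).
Proof.
rewrite !big_ord_recl big_ord0 addr0 addrA.
by congr (F _ + F _ + F _); apply: val_inj; rewrite /= inordK.
Qed.

Lemma mulmx3E m n (A : 'M[R]_(m, 3)) (B : 'M[R]_(3, n)) i j :
  (A *m B) i j = A i (inord 0) * B (inord 0) j + A i (inord 1) * B (inord 1) j
    + A i (inord 2) * B (inord 2) j.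
Proof. by rewrite mxE sum_ord3. Qed.

Lemma forall_ord3 (p : 'I_3 -> Prop) :
  p (inord 0) -> p (inord 1) -> p (inord 2) -> forall i, p i.
Proof.
by move=> h0 h1 h2 i; rewrite -(inord_val i); case: i => -[|[|[|//]]].
Qed.

Definition vec3 (s : seq R) : 'cV[R]_3 := \col_(i < 3) s`_i.

Definition hat a : 'M[R]_3 :=
  \matrix_(i < 3, j < 3) (nth [::]
    [:: [:: 0; - a (inord 2) 0; a (inord 1) 0];
        [:: a (inord 2) 0; 0; - a (inord 0) 0];
        [:: - a (inord 1) 0; a (inord 0) 0; 0]] i)`_j.

Lemma mul_hat a x : hat a *m x = su2_bracket a x.
Proof.
by apply: col3P; rewrite mulmx3E su2_bracketE !mxE !inordK //=; ring.
Qed.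

Definition dot a b : R := (a^T *m b) 0 0.

Lemma dotE a b : dot a b = a (inord 0) 0 * b (inord 0) 0
  + a (inord 1) 0 * b (inord 1) 0 + a (inord 2) 0 * b (inord 2) 0.
Proof. by rewrite /dot mulmx3E !mxE. Qed.

Lemma trmx_mul_dot a b : a^T *m b = (dot a b)%:M.
Proof. exact: mx11_scalar. Qed.

Lemma dot_eq0 a : dot a a = 0 -> a = 0.
Proof.
rewrite dotE => h; have := (sqr_ge0 (a (inord 0) 0), sqr_ge0 (a (inord 1) 0),
  sqr_ge0 (a (inord 2) 0)) => -[[? ?] ?].
by apply: col3P; rewrite mxE; apply/eqP; rewrite -sqrf_eq0; apply/eqP; lra.
Qed.

Lemma mul_hat_self a : hat a *m a = 0.
Proof. by rewrite mul_hat su2_alternating. Qed.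

Lemma mul_tr_hat_self a : a^T *m hat a = 0.
Proof.
apply/matrixP => i; apply: forall_ord3; rewrite ord1 mulmx3E !mxE !inordK //=;
  ring.
Qed.

Lemma hat_sqr a : hat a *m hat a = a *m a^T - (dot a a)%:M.
Proof.
apply/matrixP; apply: forall_ord3; apply: forall_ord3;
  rewrite mulmx3E !mxE big_ord_recl big_ord0 !mxE -!val_eqE /= dotE !inordK //=;
  ring.
Qed.

Lemma addmxE m n (A B : 'M[R]_(m, n)) i j : (A + B) i j = A i j + B i j.
Proof. by rewrite mxE. Qed.

Lemma oppmxE m n (A : 'M[R]_(m, n)) i j : (- A) i j = - A i j.
Proof. by rewrite mxE. Qed.

Lemma scalemxE m n (t : R) (A : 'M[R]_(m, n)) i j : (t *: A) i j = t * A i j.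
Proof. by rewrite mxE. Qed.

Lemma mulmx_delta P (i j : 'I_3) : (P *m delta_mx i 0 : 'cV_3) j 0 = P j i.
Proof. by rewrite -colE mxE. Qed.

(** The condition is bilinear and alternating in [x], [y], so the three cyclic pairs of basis
    vectors carry all of it. The hypotheses of [skew_plus_symmetric] are linear combinations of the
    resulting nine scalar equations. *)
Lemma su2_endoP P :
  (forall x y, su2_bracket (P *m x) (P *m y) - su2_bracket x y
     = P *m (su2_bracket (P *m x) y + su2_bracket x (P *m y))) ->
  exists t a, dot a a = 1 /\ P = t *: (a *m a^T) + hat a.
Proof.
move=> HP.
set a00 : R := P (inord 0) (inord 0).
set a01 : R := P (inord 0) (inord 1).
set a02 : R := P (inord 0) (inord 2).
set a10 : R := P (inord 1) (inord 0).
set a11 : R := P (inord 1) (inord 1).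
set a12 : R := P (inord 1) (inord 2).
set a20 : R := P (inord 2) (inord 0).
set a21 : R := P (inord 2) (inord 1).
set a22 : R := P (inord 2) (inord 2).
have E0 := HP (delta_mx (inord 1) 0) (delta_mx (inord 2) 0).
have E1 := HP (delta_mx (inord 2) 0) (delta_mx (inord 0) 0).
have E2 := HP (delta_mx (inord 0) 0) (delta_mx (inord 1) 0).
have entry i := (congr1 (fun M : 'cV_3 => M i 0) E0,
  congr1 (fun M : 'cV_3 => M i 0) E1, congr1 (fun M : 'cV_3 => M i 0) E2).
have := (entry (inord 0), entry (inord 1), entry (inord 2)).
rewrite !(mulmx3E P) !addmxE !oppmxE !su2_bracketE !mulmx_delta.
rewrite !mxE -!val_eqE /= !inordK //=.
rewrite -/a00 -/a01 -/a02 -/a10 -/a11 -/a12 -/a20 -/a21 -/a22.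
move=> [[[[e00 e01] e02] [[e10 e11] e12]] [[e20 e21] e22]].
(* The entries of the symmetric part of [P], then the axial vector of its skew part. *)
case: (@skew_plus_symmetric R a00 a11 a22 ((a01 + a10) / 2) ((a02 + a20) / 2)
  ((a12 + a21) / 2) ((a21 - a12) / 2) ((a02 - a20) / 2) ((a10 - a01) / 2)).
1-9: lra.
move=> n1 [hp hq hr] [hx hy hz].
set t := a00 + a11 + a22 in hp hq hr hx hy hz.
exists t, (vec3 [:: (a21 - a12) / 2; (a02 - a20) / 2; (a10 - a01) / 2]).
split; first by rewrite dotE !mxE !inordK //= -!expr2.
apply/matrixP; apply: forall_ord3; apply: forall_ord3;
  rewrite addmxE scalemxE mxE big_ord_recl big_ord0 !mxE !inordK //=;
  rewrite -/a00 -/a01 -/a02 -/a10 -/a11 -/a12 -/a20 -/a21 -/a22; lra.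
Qed.

(** * Rank one form of the off-diagonal blocks *)

Lemma su2_bracket0l u : su2_bracket 0 u = 0.
Proof. by apply: col3P; rewrite su2_bracketE !mxE; ring. Qed.

Lemma su2_bracket0r u : su2_bracket u 0 = 0.
Proof. by apply: col3P; rewrite su2_bracketE !mxE; ring. Qed.

Lemma dot_mul_hat a x : dot a (hat a *m x) = 0.
Proof. by rewrite /dot mulmxA mul_tr_hat_self mul0mx mxE. Qed.

(** For [v] orthogonal to the unit vector [a], the double cross product is [dot v v *: a]. *)
Lemma su2_bracket_perp_eq0 a v :
  dot a a = 1 -> dot a v = 0 -> su2_bracket v (hat a *m v) = 0 -> v = 0.
Proof.
move=> a1 av h; apply: dot_eq0.
have : dot a (su2_bracket v (hat a *m v)) = dot v v * dot a a - dot a v ^+ 2.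
  by rewrite mul_hat !dotE !su2_bracketE; ring.
rewrite h a1 av mulr1 expr0n subr0 => <-.
by rewrite /dot mulmx0 mxE.
Qed.

(** On the plane orthogonal to [b], [hat b] is a quarter turn, so [hat b *m z = - y] and both
    brackets pair collinear vectors. *)
Lemma bracket_perp b x (y := hat b *m x) (z := hat b *m y) : dot b b = 1 ->
  su2_bracket z z + su2_bracket y (hat b *m z) = 0.
Proof.
move=> b1; rewrite su2_alternating add0r.
have -> : hat b *m z = - y.
  rewrite mulmxA hat_sqr b1 mulmxBl mul1mx -mulmxA trmx_mul_dot.
  by rewrite dot_mul_hat mul_mx_scalar scale0r sub0r.
by rewrite -scaleN1r -mul_hat -scalemxAr mul_hat su2_alternating scaler0.
Qed.

Lemma tr_outer a b : \tr (a *m b^T) = dot b a.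
Proof. by rewrite mxtrace_mulC trmx_mul_dot mxtrace_scalar. Qed.

Lemma outer_mul a b x : a *m b^T *m x = dot b x *: a.
Proof. by rewrite -mulmxA trmx_mul_dot mul_mx_scalar. Qed.

Lemma sqr_endo t a : dot a a = 1 ->
  (t *: (a *m a^T) + hat a) *m (t *: (a *m a^T) + hat a)
    = (t ^+ 2 + 1) *: (a *m a^T) - 1%:M.
Proof.
move=> a1; rewrite mulmxDl !mulmxDr hat_sqr a1 -!scalemxAl -!scalemxAr.
rewrite mulmxA outer_mul a1 scale1r -(mulmxA a) mul_tr_hat_self mulmx0.
rewrite mulmxA mul_hat_self mul0mx !scaler0 addr0 add0r scalerA -expr2.
by rewrite scalerDl scale1r addrA.
Qed.

(** Stated for [Q]; exchanging the two factors gives the same conclusion for [S]. *)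
Lemma off_diagonal_block t s a b Q S
    (P := t *: (a *m a^T) + hat a) (T := s *: (b *m b^T) + hat b) :
  dot a a = 1 -> dot b b = 1 ->
  P *m P + Q *m S = - 1%:M -> S *m Q + T *m T = - 1%:M ->
  P *m Q + Q *m T = 0 ->
  (forall y z, su2_bracket (Q *m y) (Q *m z)
     = Q *m (su2_bracket (T *m y) z + su2_bracket y (T *m z))) ->
  exists eta, Q = eta *: (a *m b^T).
Proof.
move=> a1 b1; rewrite /P /T !sqr_endo // => hQS hSQ hPQ hN.
have QS : Q *m S = - (t ^+ 2 + 1) *: (a *m a^T).
  move/(canRL (addKr _)): hQS => ->.
  by rewrite opprB addrAC subrr sub0r scaleNr.
have SQ : S *m Q = - (s ^+ 2 + 1) *: (b *m b^T).
  move/(canRL (addrK _)): hSQ => ->.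
  by rewrite opprB addrA addNr sub0r scaleNr.
(* Compare the traces of [Q *m S] and [S *m Q]. *)
have ts : t ^+ 2 + 1 = s ^+ 2 + 1.
  have := mxtrace_mulC Q S; rewrite QS SQ !mxtraceZ !tr_outer a1 b1 !mulr1.
  exact: oppr_inj.
(* Compute [Q *m S *m Q] in two ways and cancel the nonzero factor [- (s ^+ 2 + 1)]. *)
have aQ : a *m a^T *m Q = Q *m (b *m b^T).
  have := mulmxA Q S Q; rewrite QS SQ ts -scalemxAr -scalemxAl => /esym.
  by apply: scalerI; rewrite oppr_eq0 lt0r_neq0 // ltr_wpDl ?sqr_ge0.
pose eta := dot a (Q *m b); exists eta.
have Qb : Q *m (b *m b^T) = eta *: (a *m b^T).
  have /(congr1 (mulmx^~ b)) := aQ; rewrite /= -!mulmxA !trmx_mul_dot b1.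
  rewrite !mul_mx_scalar scale1r => /esym Qb.
  by rewrite mulmxA Qb scalemxAl.
have aQhb : a^T *m Q *m hat b = 0.
  have : a *m (a^T *m Q *m hat b) = 0.
    rewrite !mulmxA aQ Qb -scalemxAl -mulmxA mul_tr_hat_self.
    by rewrite mulmx0 scaler0.
  move/(congr1 (mulmx a^T)); rewrite mulmxA trmx_mul_dot a1 mulmx0.
  by rewrite mul1mx.
(* The projector [a *m a^T] fixes the first summand of [e] and kills the second, so both vanish. *)
have comm : hat a *m Q = - (Q *m hat b).
  have e : (t + s) *: (eta *: (a *m b^T)) + (hat a *m Q + Q *m hat b) = 0.
    rewrite -[RHS]hPQ mulmxDl mulmxDr -scalemxAl -scalemxAr aQ Qb scalerDl.
    by rewrite addrACA.
  suff e0 : (t + s) *: (eta *: (a *m b^T)) = 0.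
    by move: e; rewrite e0 add0r => /eqP; rewrite addr_eq0 => /eqP.
  have := congr1 (mulmx (a *m a^T)) e.
  rewrite mulmx0 !mulmxDr -!scalemxAr !(mulmxA (a *m a^T)) outer_mul a1 scale1r.
  rewrite -(mulmxA a) mul_tr_hat_self mulmx0 mul0mx add0r.
  by rewrite -!(mulmxA a) aQhb mulmx0 addr0.
have Qhb0 : Q *m hat b = 0.
  suff h x : Q *m (hat b *m x) = 0.
    apply/matrixP => i j.
    have := congr1 (fun M : 'cV_3 => M i 0) (h (delta_mx j 0)).
    by rewrite mulmxA mulmx_delta !mxE.
  (* With [y = hat b x] and [z = hat b y], [Q z] is [- hat a (Q y)], so the
     integrability condition on [y, z] is [[Q y, hat a (Q y)] = 0]. *)
  apply: (@su2_bracket_perp_eq0 a) => //.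
    by rewrite /dot !mulmxA aQhb mul0mx mxE.
  have -> : hat a *m (Q *m (hat b *m x)) = - (Q *m (hat b *m (hat b *m x))).
    by rewrite mulmxA comm mulNmx -mulmxA.
  have Tb y : (s *: (b *m b^T) + hat b) *m (hat b *m y) = hat b *m (hat b *m y).
    by rewrite mulmxDl -scalemxAl outer_mul dot_mul_hat scale0r scaler0 add0r.
  rewrite -scaleN1r -mul_hat -scalemxAr (mul_hat (Q *m _)) hN !Tb.
  by rewrite bracket_perp // mulmx0 scaler0.
(* As [hat b] squares to [b *m b^T - 1%:M], this says that [Q = Q *m (b *m b^T)]. *)
have /(congr1 (mulmx^~ (hat b))) := Qhb0.
rewrite /= mul0mx -mulmxA hat_sqr b1 mulmxBr mulmx1 Qb => /eqP.
by rewrite subr_eq0 => /eqP.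
Qed.

(** * The defining equations of a complex structure in block form *)

Lemma nijenhuis_blocks P Q S T (x x' y y' : 'cV[R]_3)
    (J := endo_of_mx (block_mx P Q S T)) (X : su2su2 R := col_mx x x')
    (Y : su2su2 R := col_mx y y')
    (jx := P *m x + Q *m x') (jx' := S *m x + T *m x')
    (jy := P *m y + Q *m y') (jy' := S *m y + T *m y')
    (u := su2_bracket jx y + su2_bracket x jy)
    (u' := su2_bracket jx' y' + su2_bracket x' jy') :
  lie_bracket (J X) (J Y) - lie_bracket X Y - J (lie_bracket (J X) Y)
     - J (lie_bracket X (J Y))
  = col_mx (su2_bracket jx jy - su2_bracket x y - (P *m u + Q *m u'))
      (su2_bracket jx' jy' - su2_bracket x' y' - (S *m u + T *m u')).
Proof.
rewrite -addrA -opprD -linearD /= /su2su2_bracket !mul_block_col.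
rewrite !col_mxKu !col_mxKd add_col_mx mul_block_col.
by rewrite -!scaleN1r !scale_col_mx !add_col_mx.
Qed.

(** The bracket conditions come from pairs in a single factor: the first factor yields those on [P]
    and [S], the second those on [T] and [Q]. *)
Lemma complex_structure_blocks P Q S T :
  complex_structure (endo_of_mx (block_mx P Q S T)) ->
  [/\ P *m P + Q *m S = - 1%:M, P *m Q + Q *m T = 0,
      S *m P + T *m S = 0 & S *m Q + T *m T = - 1%:M] /\
  [/\ forall x y, su2_bracket (P *m x) (P *m y) - su2_bracket x y
        = P *m (su2_bracket (P *m x) y + su2_bracket x (P *m y)),
      forall x y, su2_bracket (T *m x) (T *m y) - su2_bracket x y
        = T *m (su2_bracket (T *m x) y + su2_bracket x (T *m y)),
      forall x y, su2_bracket (Q *m x) (Q *m y)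
        = Q *m (su2_bracket (T *m x) y + su2_bracket x (T *m y)) &
      forall x y, su2_bracket (S *m x) (S *m y)
        = S *m (su2_bracket (P *m x) y + su2_bracket x (P *m y))].
Proof.
case=> J2 N; split.
  have : block_mx P Q S T *m block_mx P Q S T = - 1%:M.
    apply/matrixP => i j.
    have := congr1 (fun M : 'cV_(3 + 3) => M i 0) (J2 (delta_mx j 0)).
    by rewrite /= mulmxA -colE !mxE eqxx andbT.
  rewrite mulmx_block scalar_mx_block opp_block_mx !oppr0.
  by case/eq_block_mx.
have N1 x y := etrans (esym (nijenhuis_blocks P Q S T x 0 y 0))
  (N (col_mx x 0) (col_mx y 0)).
have N2 x y := etrans (esym (nijenhuis_blocks P Q S T 0 x 0 y))
  (N (col_mx 0 x) (col_mx 0 y)).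
split=> x y; [move: (N1 x y)|move: (N2 x y)|move: (N2 x y)|move: (N1 x y)];
  rewrite -[RHS]col_mx0 => /eq_col_mx[];
  rewrite !su2_bracket0l !su2_bracket0r !(mulmx0, addr0, add0r) ?subr0.
- by move/eqP; rewrite subr_eq0 => /eqP.
- by move=> _ /eqP; rewrite subr_eq0 => /eqP.
- by move/eqP; rewrite subr_eq0 => /eqP.
- by move=> _ /eqP; rewrite subr_eq0 => /eqP.
Qed.

(** * The family in coordinate-free form is integrable *)

Definition cs_blocks t eta a b :=
  block_mx (t *: (a *m a^T) + hat a) (eta *: (a *m b^T))
    (- ((t ^+ 2 + 1) / eta) *: (b *m a^T)) (- t *: (b *m b^T) + hat b).

(** The axes are the sphere parameters with first and third signs reversed, as reading [hat a] off
    the matrix forces. *)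
Lemma cs_matrixE t eta l1 m1 n1 l2 m2 n2 :
  cs_matrix t eta l1 m1 n1 l2 m2 n2 =
  cs_blocks t eta (vec3 [:: - l1; m1; - n1]) (vec3 [:: - l2; m2; - n2]).
Proof.
have outerE a b (i j : 'I_3) : (a *m b^T) i j = a i 0 * b j 0.
  by rewrite mxE big_ord_recl big_ord0 addr0 mxE.
rewrite -[LHS]submxK; congr block_mx;
  apply/matrixP; apply: forall_ord3; apply: forall_ord3;
  rewrite ?addmxE scalemxE outerE !mxE /= !inordK //=; ring.
Qed.

(** The coefficients [f] and [g] are arbitrary so that they can absorb the contribution of the other
    factor; by [endo_mul_col] each block row of [cs_blocks] has this shape. *)
Lemma nijenhuis_axis a x y (f g : R) (jx := f *: a + hat a *m x)
    (jy := g *: a + hat a *m y) (u := su2_bracket jx y + su2_bracket x jy) :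
  dot a a = 1 ->
  dot a u = 0 /\ su2_bracket jx jy - su2_bracket x y = hat a *m u.
Proof.
rewrite /u /jx /jy !mul_hat => a1; split.
  by rewrite dotE !(addmxE, scalemxE, su2_bracketE); ring.
have a2 : a (inord 0) 0 ^+ 2 = 1 - a (inord 1) 0 ^+ 2 - a (inord 2) 0 ^+ 2.
  by rewrite -a1 dotE; ring.
by apply: col3P; rewrite !(addmxE, oppmxE, scalemxE, su2_bracketE); ring: a2.
Qed.

Lemma endo_outer p q a b : dot a a = 1 ->
  (p *: (a *m a^T) + hat a) *m (q *: (a *m b^T)) = (p * q) *: (a *m b^T).
Proof.
move=> a1; rewrite mulmxDl -!scalemxAr -scalemxAl !mulmxA outer_mul a1 scale1r.
by rewrite mul_hat_self mul0mx scaler0 addr0 scalerA mulrC.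
Qed.

Lemma outer_endo p q a b : dot b b = 1 ->
  (q *: (a *m b^T)) *m (p *: (b *m b^T) + hat b) = (q * p) *: (a *m b^T).
Proof.
move=> b1; rewrite mulmxDr -!scalemxAr -!scalemxAl !mulmxA outer_mul b1 scale1r.
by rewrite -mulmxA mul_tr_hat_self mulmx0 scaler0 addr0 scalerA mulrC.
Qed.

Lemma outer_outer p q a b : dot b b = 1 ->
  (p *: (a *m b^T)) *m (q *: (b *m a^T)) = (p * q) *: (a *m a^T).
Proof.
move=> b1; rewrite -scalemxAr -scalemxAl mulmxA outer_mul b1 scale1r.
by rewrite scalerA mulrC.
Qed.

Lemma endo_mul_col p q a b x y :
  (p *: (a *m a^T) + hat a) *m x + (q *: (a *m b^T)) *m y
    = (p * dot a x + q * dot b y) *: a + hat a *m x.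
Proof.
by rewrite mulmxDl -!scalemxAl !outer_mul !scalerA addrAC -scalerDl.
Qed.

Lemma complex_structure_cs_blocks t eta a b :
  eta != 0 -> dot a a = 1 -> dot b b = 1 ->
  complex_structure (endo_of_mx (cs_blocks t eta a b)).
Proof.
move=> eta0 a1 b1; split=> [X|X Y].
  suff J2 : cs_blocks t eta a b *m cs_blocks t eta a b = - 1%:M.
    by rewrite /= mulmxA J2 mulNmx mul1mx.
  rewrite /cs_blocks mulmx_block !sqr_endo // scalar_mx_block.
  rewrite opp_block_mx !oppr0 !endo_outer // !outer_endo // !outer_outer //.
  congr block_mx.
  - rewrite addrAC -scalerDl.
    have -> : t ^+ 2 + 1 + eta * - ((t ^+ 2 + 1) / eta) = 0 by field.
    by rewrite scale0r add0r.
  - by rewrite -scalerDl (_ : t * eta + _ = 0) ?scale0r //; ring.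
  - by rewrite -scalerDl (_ : _ * t + _ = 0) ?scale0r //; ring.
  - rewrite addrA -scalerDl.
    have -> : - ((t ^+ 2 + 1) / eta) * eta + ((- t) ^+ 2 + 1) = 0 by field.
    by rewrite scale0r add0r.
rewrite -[X]vsubmxK -[Y]vsubmxK nijenhuis_blocks !endo_mul_col.
rewrite ![_ + (- t *: _ + _) *m _]addrC !endo_mul_col.
have [au ->] := nijenhuis_axis (usubmx X) (usubmx Y)
  (t * dot a (usubmx X) + eta * dot b (dsubmx X))
  (t * dot a (usubmx Y) + eta * dot b (dsubmx Y)) a1.
have [bu ->] := nijenhuis_axis (dsubmx X) (dsubmx Y)
  (- t * dot b (dsubmx X) + - ((t ^+ 2 + 1) / eta) * dot a (usubmx X))
  (- t * dot b (dsubmx Y) + - ((t ^+ 2 + 1) / eta) * dot a (usubmx Y)) b1.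
by rewrite au bu !mulr0 !addr0 !scale0r !add0r !subrr col_mx0.
Qed.

(** * Classification *)

Lemma cs_blocksP (A : 'M[R]_(3 + 3)) : complex_structure (endo_of_mx A) ->
  exists t eta a b,
    [/\ eta != 0, dot a a = 1, dot b b = 1 & A = cs_blocks t eta a b].
Proof.
rewrite -[A]submxK => /complex_structure_blocks.
set P := ulsubmx A; set Q := ursubmx A; set S := dlsubmx A; set T := drsubmx A.
move=> [[PP PQ SP SQ] [NP NT NQ NS]].
have [t [a [a1 eP]]] := su2_endoP NP; have [s [b [b1 eT]]] := su2_endoP NT.
rewrite eP eT in PP PQ SP SQ NQ NS.
have [eta eQ] := off_diagonal_block a1 b1 PP SQ PQ NQ.
(* Reorder the sums to match the lemma with the two factors exchanged. *)
rewrite addrC in SQ; rewrite addrC in PP; rewrite addrC in SP.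
have [sg eS] := off_diagonal_block b1 a1 SQ PP SP NS.
have aa0 : a *m a^T != 0.
  by apply/eqP => h; move: (tr_outer a a); rewrite h a1 mxtrace0 => /esym/eqP;
    rewrite oner_eq0.
have ab0 : a *m b^T != 0.
  apply/eqP => h; have := outer_outer 1 1 a b1; rewrite h scaler0 mul0mx.
  by rewrite mulr1 scale1r => /esym/eqP; rewrite (negPf aa0).
(* The coefficient of [a *m a^T] in the upper left block of the square; its being nonzero gives
   [eta != 0]. *)
have es : eta * sg = - (t ^+ 2 + 1).
  move: PP; rewrite eQ eS outer_outer // sqr_endo // addrA -scalerDl => /eqP.
  rewrite -subr_eq0 opprK addrNK scaler_eq0 (negPf aa0) orbF addr_eq0.
  by move/eqP.
have eta0 : eta != 0.
  apply/eqP => h; move: es; rewrite h mul0r => /eqP; rewrite eq_sym oppr_eq0.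
  by apply/negP; rewrite lt0r_neq0 // ltr_wpDl ?sqr_ge0.
(* The coefficient of [a *m b^T] in the upper right block is [eta * (t + s)]. *)
have st : s = - t.
  move: PQ; rewrite eQ endo_outer // outer_endo // -scalerDl => /eqP.
  rewrite scaler_eq0 (negPf ab0) orbF mulrC -mulrDr mulf_eq0 (negPf eta0).
  by rewrite addrC addr_eq0 => /eqP.
exists t, eta, a, b; split=> //.
rewrite /cs_blocks eP eQ eS eT st; congr (block_mx _ _ (_ *: _) _).
by rewrite -mulNr -es mulrC mulKf.
Qed.

End Su2.

Theorem corollary4 (R : realType) (A : 'M[R]_(3 + 3)) :
  complex_structure (endo_of_mx A) <->
  exists xi eta l1 m1 n1 l2 m2 n2 : R,
    [/\ eta != 0, in_sphere2 l1 m1 n1, in_sphere2 l2 m2 n2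
      & A = cs_matrix xi eta l1 m1 n1 l2 m2 n2].
Proof.
split=> [/cs_blocksP[t [eta [a [b [eta0 a1 b1 ->]]]]] | ].
  (* The sign change between axes and sphere parameters is an involution, hence the double
     negations. *)
  have vec3E (v : 'cV[R]_3) : v = vec3 [:: - - v (inord 0) 0; v (inord 1) 0;
      - - v (inord 2) 0].
    by apply: col3P; rewrite !mxE !inordK //= !opprK.
  exists t, eta, (- a (inord 0) 0), (a (inord 1) 0), (- a (inord 2) 0),
    (- b (inord 0) 0), (b (inord 1) 0), (- b (inord 2) 0).
  split=> //; first by rewrite /in_sphere2 -a1 dotE; ring.
    by rewrite /in_sphere2 -b1 dotE; ring.
  by rewrite cs_matrixE -!vec3E.
move=> [t [eta [l1 [m1 [n1 [l2 [m2 [n2 [eta0 h1 h2 ->]]]]]]]]].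
rewrite cs_matrixE; apply: complex_structure_cs_blocks => //.
  by rewrite -h1 dotE !mxE !inordK //=; ring.
by rewrite -h2 dotE !mxE !inordK //=; ring.
Qed.
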